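(* Let $f(n)=H_2(n,n)$ for integers $n\geq1$. Then for all integers $n\geq 1$, $$\begin{aligned} &32 (n+1) (2 n+1)^2\bigl(1575 n^6+21285 n^5+117954 n^4+343020 n^3+551943 n^2+465785 n+161046\bigr) f(n)\\ &-8 \bigl(121275 n^9+1933470 n^8+13267683 n^7+51280818 n^6+122556360 n^5+186866686 n^4\\ &\qquad +180574335 n^3+105734340 n^2+33718283 n+4443102\bigr) f(n+1)\\ &+2 \bigl(294525 n^9+4763070 n^8+33170868n^7+130145646 n^6+315713355 n^5+488415476 n^4\\ &\qquad+478464380 n^3+283626704 n^2+91378536 n+12137328\bigr) f(n+2)\\ &+\bigl(294525 n^9+4668570n^8+31877118 n^7+122735586 n^6+292620525 n^5+445804136 n^4\\ &\qquad+431097970 n^3+252913504 n^2+80866406 n+10688508\bigr) f(n+3)\\ &-\bigl(121275n^9+1961820 n^8+13655808 n^7+53503836 n^6+129484209 n^5+199650088 n^4\\ &\qquad+194784258 n^3+114948300 n^2+36871922 n+4877748\bigr) f(n+4)\\ &+2 (2 n+7) \bigl(1575 n^6+11835 n^5+35154 n^4+52554 n^3+41382 n^2+16118 n+2428\bigr) (n+3)^2 f(n+5)=0. \end{aligned}$$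
   Context: For positive integers $r,n,k$, let $H_r(n,k)$ be the number of $n\times k$ arrays of integers (rows indexed $i=1,\dots,n$, columns indexed $j=1,\dots,k$) which obey the following rules: (1) the entry in position $(1,1)$ is $0$, and the entry in position $(n,k)$ is $\max(n,k)-r-1$; (2) the entry in position $(i,j)$ must equal or be one more than each of the entries in positions $(i-1,j)$, $(i,j-1)$, and $(i-1,j-1)$ (whenever those positions exist in the array); (3) the entry in position $(i,j)$ must be within $r$ of $\max(i,j)-1$, i.e. differ from it by at most $r$ in absolute value. (If the rules are contradictory, the count is $0$; for instance $H_2(1,1)=H_2(2,2)=0$.) *)

(* Defs.v *)
From Stdlib Require Import ZArith.
From mathcomp Require Import all_boot all_order all_algebra finmap.
From mathcomp Require Import boolp classical_sets functions cardinality.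
From mathcomp Require Import zify.

Set Implicit Arguments.
Unset Strict Implicit.
Unset Printing Implicit Defensive.

Import Order.TTheory GRing.Theory Num.Theory.

Local Open Scope ring_scope.

Definition equal_or_one_more (x y : int) : Prop := y = x \/ y = x + 1.

(* Row i and column j of the matrix are row i + 1 and column j + 1 of the array,
   so that max(i, j) below is max(i, j) - 1 for the array positions. *)
Definition legal (r n k : nat) (A : 'M[int]_(n, k)) : Prop :=
  [/\ (forall (i : 'I_n) (j : 'I_k),
         i = 0%N :> nat -> j = 0%N :> nat -> A i j = 0)
      /\ (forall (i : 'I_n) (j : 'I_k),
         i.+1 = n -> j.+1 = k -> A i j = (maxn n k)%:Z - r%:Z - 1),
      [/\ forall (i' i : 'I_n) (j : 'I_k),
            i = i'.+1 :> nat -> equal_or_one_more (A i' j) (A i j),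
          forall (i : 'I_n) (j' j : 'I_k),
            j = j'.+1 :> nat -> equal_or_one_more (A i j') (A i j)
        & forall (i' i : 'I_n) (j' j : 'I_k),
            i = i'.+1 :> nat -> j = j'.+1 :> nat ->
            equal_or_one_more (A i' j') (A i j)]
    & forall (i : 'I_n) (j : 'I_k), `|A i j - (maxn i j)%:Z| <= r%:Z].

Definition legal_arrays (r n k : nat) : set 'M[int]_(n, k) :=
  [set A | legal r A]%classic.
Arguments legal_arrays : clear implicits.

(* [fset_set] sends infinite sets to the empty set; this case does not occur
   here. *)
Lemma finite_legal_arrays (r n k : nat) : finite_set (legal_arrays r n k).
Proof.
pose b := (maxn n k + r)%N.
pose g (B : 'M['I_b.+1.*2]_(n, k)) : 'M[int]_(n, k) :=
  \matrix_(i, j) ((B i j : nat)%:Z - b%:Z).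
apply: (@sub_finite_set _ _ (g @` setT)%classic); last first.
  by apply: finite_image; exact: finite_finset.
move=> A [_ _ near_max]; exists (\matrix_(i, j) inord (absz (A i j + b%:Z))) => //.
apply/matrixP => i j; rewrite !mxE.
have := near_max i j; have := ltn_ord i; have := ltn_ord j.
move=> lt_j lt_i; move: (A i j) => a; rewrite /b.
move: (i : nat) (j : nat) lt_i lt_j => {}i {}j lt_i lt_j le_r.
have [a_ge0 a_lt]: 0 <= a + (maxn n k + r)%:Z /\
    (absz (a + (maxn n k + r)%:Z)%R < (maxn n k + r).*2.+2)%N by lia.
rewrite inordK; [lia | exact: a_lt].
Qed.

Definition H (r n k : nat) : nat := #|` fset_set (legal_arrays r n k)|.

(* The sequence takes values in the binary integers because numerals of type
   [int] are unary. *)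
Definition f (n : nat) : Z := Z.of_nat (H 2 n n).

(* Main.v *)
(** For an array A let B(i, j) = max(i, j) - A(i, j), the deficit.  On the upper
    triangle B takes values in {0, 1, 2}, is nondecreasing to the right and along
    diagonals, nonincreasing downwards, and all its steps are at most 1; the last
    column is constantly 2.  So row i is given by the numbers e_1 <= e_2 of cells,
    from the diagonal on, with deficit less than 1 and less than 2.  From one row to the
    one above, each e_v stays or grows by 1, and the rules amount to e_1 < e_2 or
    e_1 = e_2 = 0.  The lower triangle behaves in the same way and is coupled to the
    upper one only through the diagonal, that is, through the rows at which e_1
    and e_2 become positive.  Grouping by these two rows, H_2(n, n) is a sum of squares,
    and the reflection principle gives
      f(n+1) - f(n) = g(n-1),  g(s) = sum_(a < s) F(s, a)^2,
      F(s, a) = sum_(a < j <= s) C(s+a, j).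
    Since F(s+1, a) = 2 F(s, a) + C(s+a+1, a), the sum g(s+1) - 4 g(s) = w(s) is
    linear in F, and w(s+1) + 2 w(s) is free of F by summation by parts.  Gosper's
    method reduces it to K(s) = sum_(a <= s) C(s+a, a)^2 and the boundary term
    C(2s+1, s+1)^2, both of which satisfy first order recurrences.  Rewriting
    everything at s = n-1 in terms of f(n), g, w, K and C(2s+1, s+1), the asserted
    relation becomes an identity of rational functions. *)

From HB Require Import structures.
From Stdlib Require Import ZArith Reals Lra.
From mathcomp Require Import all_boot all_order all_algebra finmap.
From mathcomp Require Import boolp classical_sets functions cardinality.
From mathcomp Require Import zify.
Require Import Defs.

Set Implicit Arguments.
Unset Strict Implicit.
Unset Printing Implicit Defensive.

Local Open Scope nat_scope.

(** * Walks encoding the arrays *)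

(* A pair [p] describes one row of the upper triangle (or one column of the lower
   one): going away from the diagonal, the deficit is at least v after exactly
   the first e_v cells, for p = (e_1, e_2). *)
Definition admissible (p : nat * nat) : bool := (p.1 < p.2) || (p == (0, 0)).

Definition level (p : nat * nat) (t : nat) : nat := (p.1 <= t) + (p.2 <= t).

Definition half_successors (p : nat * nat) : seq (nat * nat) :=
  [seq q <- [:: p; (p.1, p.2.+1); (p.1.+1, p.2); (p.1.+1, p.2.+1)]
     | admissible q].

(** A row and the column of the same index share their diagonal cell, so its deficit must be the
    same in both. *)
Definition same_diagonal (p q : nat * nat) : bool :=
  ((p.1 == 0) == (q.1 == 0)) && ((p.2 == 0) == (q.2 == 0)).

Definition state : Type := ((nat * nat) * (nat * nat))%type.

Definition successors (s : state) : seq state :=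
  [seq (p, q) | p <- half_successors s.1,
                q <- [seq q <- half_successors s.2 | same_diagonal p q]].

(** The corner (1, 1) has entry 0, hence deficit 0. *)
Definition final (s : state) : bool := (0 < s.1.1) && (0 < s.1.2).

Fixpoint walks (k : nat) (s : state) : seq (seq state) :=
  if k is k'.+1 then [seq t :: l | t <- successors s, l <- walks k' t]
  else if final s then [:: [::]] else [::].

Lemma mem_half_successors p q :
  (q \in half_successors p) =
  [&& (q.1 == p.1) || (q.1 == p.1.+1), (q.2 == p.2) || (q.2 == p.2.+1)
    & admissible q].
Proof.
case: p q => [x y] [x' y']; rewrite mem_filter /= !inE !xpair_eqE /= andbC.
by do 4 case: eqVneq => ? //=; case: admissible.
Qed.

Lemma half_successors_uniq p : uniq (half_successors p).
Proof.
case: p => x y; apply: filter_uniq; rewrite /= !inE !xpair_eqE /=; lia.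
Qed.

Lemma mem_successors s t :
  (t \in successors s) =
  [&& t.1 \in half_successors s.1, t.2 \in half_successors s.2 & same_diagonal t.1 t.2].
Proof.
case: t => p q; apply/allpairsPdep/and3P => /=.
  by move=> [p' [q' [Hp]]]; rewrite mem_filter => /andP[Hd Hq] [-> ->].
by move=> [Hp Hq Hd]; exists p, q; split=> //; rewrite mem_filter Hd.
Qed.

Lemma successors_uniq s : uniq (successors s).
Proof.
apply: allpairs_uniq_dep => [|p _|]; first exact: half_successors_uniq.
  by rewrite filter_uniq ?half_successors_uniq.
by move=> [? ?] [? ?] _ _ /= [-> ->].
Qed.

Lemma mem_walks k s l :
  (l \in walks k s) =
  [&& size l == k, path (fun s t => t \in successors s) s l & final (last s l)].
Proof.
elim: k s l => [|k IH] s l /=.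
  by case: l => [|t l] /=; case: final.
case: l => [|t l] /=.
  by apply/negbTE/negP => /allpairsPdep[? [? []]].
rewrite eqSS; apply/allpairsPdep/and3P => /=.
  move=> [t' [l' [Ht Hl [-> ->]]]]; move: Hl; rewrite IH => /and3P[-> -> ->].
  by rewrite Ht.
move=> [Hs /andP[Ht Hp] Hf]; exists t, l; split=> //.
by rewrite IH Hs Hp Hf.
Qed.

Lemma walks_uniq k s : uniq (walks k s).
Proof.
elim: k s => [|k IH] s /=; first by case: final.
apply: allpairs_uniq_dep => [|t _|]; [exact: successors_uniq | exact: IH |].
by move=> [? ?] [? ?] _ _ /= [-> ->].
Qed.

(** * Counting the walks *)

Lemma size_walksS k s :
  size (walks k.+1 s) =
  \sum_(p <- half_successors s.1) \sum_(q <- half_successors s.2 | same_diagonal p q)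
     size (walks k (p, q)).
Proof.
rewrite /= size_allpairs_dep sumnE big_map big_allpairs_dep.
by apply: eq_bigr => p _; rewrite big_filter.
Qed.

(* [rho k D] counts the pairs of length-k paths with steps 0 or 1 that start at
   distance D and never meet; [theta j a y] counts the continuations of a row (0, y)
   that keep e_1 = 0 for j steps, then make e_1 positive, then take a more steps. *)
Fixpoint rho (k D : nat) : nat :=
  if D is D'.+1 then
    if k is k'.+1 then rho k' D'.+2 + 2 * rho k' D'.+1 + rho k' D' else 1
  else 0.

Fixpoint theta (j a y : nat) : nat :=
  if j is j'.+1 then theta j' a y + theta j' a y.+1 else rho a y + rho a y.-1.

Lemma rho0 k : rho k 0 = 0. Proof. by case: k. Qed.

(** Admissibility drops exactly the successor at distance 0, for which [rho] vanishes. *)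
Lemma rhoS k x y :
  x < y -> rho k.+1 (y - x) = \sum_(q <- half_successors (x, y)) rho k (q.2 - q.1).
Proof.
move=> ltxy; rewrite big_filter !big_cons big_nil /admissible /= ltxy.
rewrite (ltn_trans ltxy) // ltnS ltxy /= !xpair_eqE /= orbF.
have [d ->] : exists d, y = x + d.+1 by exists (y - x.+1); lia.
rewrite (_ : (x.+1 < x + d.+1) = (0 < d)); last lia.
rewrite addnS !subSS -!addnS !addKn.
by case: d => [|d] /=; rewrite ?rho0; lia.
Qed.

Lemma half_successors_inside p q :
  0 < p.1 < p.2 -> q \in half_successors p -> 0 < q.1 < q.2.
Proof.
move=> /andP[p0 _]; rewrite mem_half_successors => /and3P[q1 _ /orP[q2|/eqP q2]].
  by rewrite q2 andbT; case/orP: q1 => /eqP ->.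
by move: q1; rewrite q2 /=; case: (p.1) p0.
Qed.

Lemma same_diagonal_inside p q :
  0 < p.1 < p.2 -> 0 < q.1 < q.2 -> same_diagonal p q.
Proof. by case: p q => [[|x] [|y]] [[|x'] [|y']]. Qed.

(** Once all thresholds are positive they stay so; [same_diagonal] then always holds and the
    triangles evolve independently. *)
Lemma size_walks_inside k x y x' y' :
  0 < x < y -> 0 < x' < y' ->
  size (walks k ((x, y), (x', y'))) = rho k (y - x) * rho k (y' - x').
Proof.
elim: k x y x' y' => [|k IH] x y x' y' Hxy Hxy'.
  rewrite /= /final /=.
  have [d ->] : exists d, y - x = d.+1 by exists (y - x).-1; lia.
  have [d' ->] : exists d', y' - x' = d'.+1 by exists (y' - x').-1; lia.
  by rewrite (_ : _ && _) //=; lia.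
have [/andP[_ lt] /andP[_ lt']] := (Hxy, Hxy').
rewrite size_walksS !rhoS // big_distrlr /= big_seq [RHS]big_seq.
apply: eq_bigr => -[p1 p2] /(@half_successors_inside (x, y) _ Hxy) Hp.
rewrite big_seq_cond [RHS]big_seq; apply: congr_big => //.
  move=> q; case Hq: (q \in _) => //=.
  exact: (same_diagonal_inside Hp (@half_successors_inside (x', y') q Hxy' Hq)).
by move=> [q1 q2] /andP[/(@half_successors_inside (x', y') _ Hxy') Hq _]; exact: IH.
Qed.

(** [same_diagonal] makes both e_1 positive in the same step; [a] is the number of steps left after
    it. *)
Lemma size_walks_edge k y y' :
  0 < y -> 0 < y' ->
  size (walks k ((0, y), (0, y'))) =
  \sum_(a < k) theta (k - a.+1) a y * theta (k - a.+1) a y'.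
Proof.
elim: k y y' => [|k IH] y y' y0 y0'; first by rewrite big_ord0.
have E a : a < k -> k.+1 - a.+1 = (k - a.+1).+1 by lia.
rewrite size_walksS big_ord_recr /= subnn /=.
under [X in _ = X + _]eq_bigr => a _ do rewrite E //= mulnDl !mulnDr.
rewrite !big_split /= -!IH // /half_successors /=.
rewrite /admissible /= !xpair_eqE /= y0 y0' !ltnS /= !orbF.
have rhoE z z' : 0 < z -> 0 < z' ->
    size (walks k (1, z.+1, (1, z'.+1))) = rho k z * rho k z'.
  by move=> ? ?; rewrite size_walks_inside // !subn1.
case: (y) y0 => [|[|z]] // _; case: (y') y0' => [|[|z']] // _ /=.
all: rewrite !(big_cons, big_nil) /same_diagonal /=.
all: rewrite !rhoE //.
all: rewrite ?rho0; nia.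
Qed.

Definition origin : state := ((0, 0), (0, 0)).

(** The only move away from [origin] makes both e_2 equal to 1; [i] is the number of steps left
    after it. *)
Lemma size_walks_origin k :
  size (walks k origin) = \sum_(i < k) \sum_(a < i) theta (i - a.+1) a 1 ^ 2.
Proof.
elim: k => [|k IH]; first by rewrite big_ord0.
rewrite size_walksS big_ord_recr /= -IH /half_successors /=.
by rewrite !(big_cons, big_nil) /= !addn0 (@size_walks_edge k 1 1).
Qed.

(** * The bijection between arrays and walks *)

Lemma leq_levelS p t :
  admissible p -> level p t <= level p t.+1 <= (level p t).+1.
Proof.
case: p => x y; rewrite /admissible /level /= xpair_eqE.
case: (leqP x t); case: (leqP y t); case: (leqP x t.+1);
  case: (leqP y t.+1) => /=; lia.
Qed.

(** [q] describes the row above that of [p], starting one column earlier: the first line compares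
    diagonal neighbours, the second vertical ones. *)
Lemma leq_level_successor p q t : admissible p -> q \in half_successors p ->
  level q t <= level p t <= (level q t).+1 /\
  level p t <= level q t.+1 <= (level p t).+1.
Proof.
case: p q => x y [x' y']; rewrite mem_half_successors /admissible /level /= !xpair_eqE.
case: (leqP x t); case: (leqP y t); case: (leqP x' t); case: (leqP y' t);
  case: (leqP x' t.+1); case: (leqP y' t.+1) => /=; lia.
Qed.

(** At the smaller of two distinct first thresholds the levels differ; if these agree, they differ
    at the smaller second one. *)
Lemma level_inj k p q : admissible p -> admissible q -> p.2 <= k -> q.2 <= k ->
  (forall t, t <= k -> level p t = level q t) -> p = q.
Proof.
have lt1 (u v : nat * nat) : admissible v -> u.1 < v.1 -> level u u.1 <> level v u.1.
  case: u v => x y [x' y']; rewrite /admissible /level /= xpair_eqE => Hv lt.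
  by rewrite leqnn (leqNgt x') lt (_ : (y' <= x) = false); lia.
have lt2 (u v : nat * nat) : admissible u -> u.1 = v.1 -> u.2 < v.2 ->
    level u u.2 <> level v u.2.
  case: u v => x y [x' y']; rewrite /admissible /level /= xpair_eqE => Hu <- lt.
  by rewrite leqnn (leqNgt y') lt; case: (leqP x y); lia.
move=> ap aq lep leq E.
have le12 (u : nat * nat) : admissible u -> u.1 <= u.2.
  by case: u => x y; rewrite /admissible /= xpair_eqE; lia.
have E1 : p.1 = q.1.
  case: (ltngtP p.1 q.1) => // lt.
    by case: (lt1 _ _ aq lt); apply: E; exact: leq_trans (le12 _ ap) lep.
  by case: (lt1 _ _ ap lt); apply/esym/E; exact: leq_trans (le12 _ aq) leq.
case: (ltngtP p.2 q.2) => [lt|lt|E2].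
- by case: (lt2 _ _ ap E1 lt); apply: E.
- by case: (lt2 _ _ aq (esym E1) lt); apply/esym/E.
by rewrite [p]surjective_pairing E1 E2 -surjective_pairing.
Qed.

Lemma same_diagonal_level p q : admissible p -> admissible q ->
  same_diagonal p q = (level p 0 == level q 0).
Proof.
case: p q => [[|x] [|y]] [[|x'] [|y']]; rewrite /admissible /same_diagonal /level //.
Qed.

Section Walk.

Variables (k : nat) (l : seq state).
Hypothesis walk_l : l \in walks k origin.

Let e i := nth origin (origin :: l) i.

Lemma walk_successor i : i < k -> e i.+1 \in successors (e i).
Proof.
by move: walk_l; rewrite mem_walks => /and3P[/eqP<- /(pathP origin) H _]; exact: H.
Qed.

Lemma walk_admissible i : i <= k ->
  [&& admissible (e i).1, admissible (e i).2 & same_diagonal (e i).1 (e i).2].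
Proof.
case: i => // i /walk_successor; rewrite mem_successors !mem_half_successors.
by move=> /and3P[/and3P[_ _ ->] /and3P[_ _ ->] ->].
Qed.

Lemma walk_bound i : i <= k -> ((e i).1.2 <= i) && ((e i).2.2 <= i).
Proof.
elim: i => [|i IH] // lti; have := walk_successor lti; move: (IH (ltnW lti)).
rewrite mem_successors !mem_half_successors.
move: (e i) (e i.+1) => [[? ?] [? ?]] [[? ?] [? ?]].
move=> /= H /and3P[/and3P[_ H1 _] /and3P[_ H2 _] _]; move: H H1 H2; lia.
Qed.

Lemma walk_final : final (e k).
Proof.
move: walk_l; rewrite mem_walks => /and3P[/eqP Es _].
by rewrite (last_nth origin) Es.
Qed.

End Walk.

(* The walk starts in the corner (n, n), so that row [i] of the upper triangle and
   column [i] of the lower one are read off its state number [N - i]. *)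
Definition deficit (N : nat) (l : seq state) (i j : nat) : nat :=
  if i <= j then level (nth origin (origin :: l) (N - i)).1 (j - i)
  else level (nth origin (origin :: l) (N - j)).2 (i - j).

Definition array_of_walk (N : nat) (l : seq state) : 'M[int]_N.+1 :=
  (\matrix_(i, j) ((maxn i j)%:Z - (deficit N l i j)%:Z))%R.

Lemma deficit_lower N l i j : l \in walks N origin -> j <= i <= N ->
  deficit N l i j = level (nth origin (origin :: l) (N - j)).2 (i - j).
Proof.
move=> Hl /andP[leji leiN]; rewrite /deficit; case: leqP => // leij.
have -> : i = j by lia.
have /and3P[ap aq] := walk_admissible Hl (leq_subr j N).
by rewrite same_diagonal_level // subnn => /eqP.
Qed.

(** Rule (2) for deficits: a step that keeps max(i, j) may lower the deficit by 1, one that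
    increases it may raise the deficit by 1. *)
Lemma deficit_step N l i j : l \in walks N origin -> i <= N -> j <= N ->
  [/\ i < N -> i < j -> deficit N l i.+1 j <= deficit N l i j <= (deficit N l i.+1 j).+1,
      i < N -> j <= i -> deficit N l i j <= deficit N l i.+1 j <= (deficit N l i j).+1,
      j < N -> j < i -> deficit N l i j.+1 <= deficit N l i j <= (deficit N l i j.+1).+1,
      j < N -> i <= j -> deficit N l i j <= deficit N l i j.+1 <= (deficit N l i j).+1
    & i < N -> j < N -> deficit N l i j <= deficit N l i.+1 j.+1 <= (deficit N l i j).+1].
Proof.
move=> Hl leiN lejN.
have adm m := walk_admissible Hl (leq_subr m N).
have step m : m < N ->
    nth origin (origin :: l) (N - m) \in successors (nth origin (origin :: l) (N - m.+1)).
  by move=> ltm; rewrite -subnSK //; apply: (walk_successor Hl); lia.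
split.
- move=> ltiN ltij; rewrite /deficit ltij (ltnW ltij).
  have := step i ltiN; rewrite mem_successors => /and3P[H _ _].
  have /and3P[a _ _] := adm i.+1.
  by rewrite -(subnSK ltij); case: (leq_level_successor (j - i.+1) a H).
- move=> ltiN leji; rewrite !deficit_lower //; [|lia..].
  by rewrite subSn //; apply: leq_levelS; case/and3P: (adm j).
- move=> ltjN ltji; rewrite !deficit_lower //; [|lia..].
  have := step j ltjN; rewrite mem_successors => /and3P[_ H _].
  have /and3P[_ a _] := adm j.+1.
  by rewrite -(subnSK ltji); case: (leq_level_successor (i - j.+1) a H).
- move=> ltjN leij; rewrite /deficit leij (leqW leij).
  by rewrite subSn //; apply: leq_levelS; case/and3P: (adm i).
move=> ltiN ltjN; case: (leqP i j) => [leij|ltji].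
  rewrite /deficit ltnS leij subSS.
  have := step i ltiN; rewrite mem_successors => /and3P[H _ _].
  have /and3P[a _ _] := adm i.+1.
  by case: (leq_level_successor (j - i) a H).
rewrite !deficit_lower //; [rewrite subSS|lia..].
have := step j ltjN; rewrite mem_successors => /and3P[_ H _].
have /and3P[_ a _] := adm j.+1.
by case: (leq_level_successor (i - j) a H).
Qed.

Lemma legal_array_of_walk N l : l \in walks N origin -> legal 2 (array_of_walk N l).
Proof.
move=> Hl.
have le2 i j : deficit N l i j <= 2.
  by rewrite /deficit; case: ifP => _; rewrite -[2]/(1 + 1) leq_add ?leq_b1.
have step (i j : 'I_N.+1) := deficit_step Hl (leq_ord i) (leq_ord j).
split; [split|split|]; rewrite /equal_or_one_more.
- move=> i j i0 j0; rewrite mxE /deficit i0 j0 /= subn0.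
  have := walk_final Hl; rewrite /final.
  by case: (nth _ _ _) => [[[|x] [|y]] q].
- move=> i j [iN] [jN]; rewrite mxE /deficit iN jN leqnn subnn /level /=; lia.
- move=> i' i j Ei; rewrite !mxE.
  have := ltn_ord i; have [H1 H2 _ _ _] := step i' j; rewrite Ei.
  by move: H1 H2; case: (leqP j i') => ? H1 H2 ?; [have := H2|have := H1]; lia.
- move=> i j' j Ej; rewrite !mxE.
  have := ltn_ord j; have [_ _ H1 H2 _] := step i j'; rewrite Ej.
  by move: H1 H2; case: (leqP i j') => ? H1 H2 ?; [have := H2|have := H1]; lia.
- move=> i' i j' j Ei Ej; rewrite !mxE.
  have := ltn_ord i; have := ltn_ord j; have [_ _ _ _ H] := step i' j'.
  by rewrite Ei Ej; move: H; lia.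
by move=> i j; rewrite mxE; have := le2 i j; lia.
Qed.

Lemma array_of_walk_inj N : {in walks N origin &, injective (array_of_walk N)}.
Proof.
move=> l l' Hl Hl' E.
have Edef i j : i <= N -> j <= N -> deficit N l i j = deficit N l' i j.
  move=> leiN lejN; move/matrixP: E => /(_ (inord i) (inord j)).
  by rewrite !mxE !inordK ?ltnS //; lia.
have Est k : k <= N -> nth origin (origin :: l) k = nth origin (origin :: l') k.
  move=> lekN.
  have /and3P[a b _] := walk_admissible Hl lekN.
  have /and3P[a' b' _] := walk_admissible Hl' lekN.
  have /andP[c d] := walk_bound Hl lekN.
  have /andP[c' d'] := walk_bound Hl' lekN.
  rewrite [LHS]surjective_pairing [RHS]surjective_pairing; congr pair.
    apply: (level_inj a a' c c') => t letk.
    have := Edef (N - k) (N - k + t); rewrite /deficit leq_addr subKn // addKn.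
    by apply; lia.
  apply: (level_inj b b' d d') => t letk.
  have := Edef (N - k + t) (N - k); rewrite !deficit_lower ?subKn ?addKn //; [|lia..].
  by apply; lia.
move: Hl Hl'; rewrite !mem_walks => /andP[/eqP sl _] /andP[/eqP sl' _].
apply: (@eq_from_nth _ origin) => [|i]; first by rewrite sl sl'.
by rewrite sl => lti; exact: (Est i.+1).
Qed.

(** * Thresholds read off a triangle of deficits *)

Section UpperTriangle.

Variables (N : nat) (B : nat -> nat -> int).
Hypothesis right_step : forall i j, i <= j -> j < N ->
  (B i j.+1 = B i j \/ B i j.+1 = B i j + 1)%R.
Hypothesis down_step : forall i j, i < j -> j <= N ->
  (B i j = B i.+1 j \/ B i j = B i.+1 j + 1)%R.
Hypothesis diag_step : forall i j, i <= j -> j < N ->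
  (B i.+1 j.+1 = B i j \/ B i.+1 j.+1 = B i j + 1)%R.
Hypothesis origin0 : B 0 0 = 0%R.
Hypothesis corner2 : B N N = 2%R.
Hypothesis le2 : forall i j, i <= N -> j <= N -> (B i j <= 2)%R.

(** The list starts at 0, so the index found is itself an offset; [last_column] guarantees a hit for
    v <= 2. *)
Let e (v i : nat) : nat :=
  find (fun t => (v%:Z <= B i (i + t))%R) (iota 0 (N - i).+1).

Lemma row_homo i t u : i + t + u <= N -> (B i (i + t) <= B i (i + t + u))%R.
Proof.
elim: u => [|u IH] le; first by rewrite addn0.
have := @right_step i (i + t + u); rewrite addnS; lia.
Qed.

Lemma diag_ge0 i : i <= N -> (0 <= B i i)%R.
Proof. by elim: i => [|i IH] lei; [rewrite origin0|have := @diag_step i i; lia]. Qed.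

(** Going up from the corner the deficit cannot decrease, and 2 is its maximum. *)
Lemma last_column i : i <= N -> B i N = 2%R.
Proof.
move=> lei; have : (2 <= B (N - (N - i)) N)%R; last first.
  by have := @le2 i N; rewrite subKn; lia.
elim: (N - i) => [|u IH]; first by rewrite subn0 corner2.
case: (leqP N u) => [?|ltu]; first by rewrite (_ : N - u.+1 = N - u); lia.
by have := @down_step (N - u.+1) N; rewrite -subSn // subSS; lia.
Qed.

Lemma threshold v i t : v <= 2 -> i + t <= N -> (v%:Z <= B i (i + t))%R = (e v i <= t).
Proof.
move=> lev le; rewrite /e; set P := (fun _ => _).
have hasP : has P (iota 0 (N - i).+1).
  apply/hasP; exists (N - i); first by rewrite mem_iota; lia.
  by rewrite /P subnKC ?last_column; lia.
apply/idP/idP => [H|le'].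
  rewrite leqNgt; apply/negP => lt; have := before_find 0 lt.
  by rewrite nth_iota ?add0n /P ?H //; lia.
have ltf : find P (iota 0 (N - i).+1) < (N - i).+1.
  by move: hasP; rewrite has_find size_iota.
have := nth_find 0 hasP; rewrite nth_iota // add0n {1}/P => H.
apply: (Order.POrderTheory.le_trans H).
by rewrite -(subnKC le') addnA; apply: row_homo; lia.
Qed.

Lemma upper_levels : exists p : nat -> nat * nat,
  [/\ forall i j, i <= j <= N -> B i j = ((level (p i) (j - i))%:Z)%R,
      forall i, i <= N -> admissible (p i),
      p N = (0, 0)
    & forall i, i < N -> p i \in half_successors (p i.+1)].
Proof.
have adm i : i <= N -> admissible (e 1 i, e 2 i).
  move=> lei; rewrite /admissible xpair_eqE /=.
  have le12 : e 1 i <= e 2 i.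
    case: (leqP (e 2 i) (N - i)) => H; last first.
      by have := @threshold 1 i (N - i); rewrite subnKC // last_column; lia.
    by rewrite -threshold //; [have := @threshold 2 i (e 2 i)|]; lia.
  have eN : e 2 i <= N - i by rewrite -threshold ?subnKC // last_column.
  (* Steps to the right are at most 1, so the cell before the first deficit 2 has deficit at least
     1. *)
  case E: (e 2 i) => [|t]; first by lia.
  have H1 := @threshold 2 i t; have H2 := @threshold 2 i t.+1.
  have H3 := @threshold 1 i t.
  have := @right_step i (i + t); rewrite addnS in H2 *; lia.
exists (fun i => (e 1 i, e 2 i)); split => //.
- move=> i j /andP[leij lejN].
  rewrite -(subnKC leij); set t := j - i; rewrite addKn /level /=.
  have [H1 H2] : i + t <= N /\ i <= N by lia.
  rewrite -!threshold // .
  have := @row_homo i 0 t; rewrite addn0 => /(_ H1) H3.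
  have := @le2 i (i + t) H2 H1; have := diag_ge0 H2; lia.
- by congr pair; apply/eqP; rewrite -leqn0 -threshold ?addn0 // corner2.
move=> i lti; rewrite mem_half_successors adm ?(ltnW lti) //= andbT.
suff H v : v <= 2 -> (e v i == e v i.+1) || (e v i == (e v i.+1).+1).
  by rewrite !H.
move=> lev.
have b0 : e v i <= N - i by rewrite -threshold ?subnKC ?last_column //; lia.
have b1 : e v i.+1 <= N - i.+1 by rewrite -threshold ?subnKC ?last_column //; lia.
(* A diagonal step from the threshold cell of row i gives this bound; a vertical step from that of
   row i+1 gives the next. *)
have le1 : e v i.+1 <= e v i.
  case: (leqP (e v i) (N - i.+1)) => [le|]; last by lia.
  rewrite -threshold //; last by lia.
  have := @threshold v i (e v i) lev; rewrite leqnn.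
  by have := @diag_step i (i + e v i); rewrite addSn; lia.
have le3 : e v i <= (e v i.+1).+1.
  rewrite -threshold //; last by lia.
  have := @threshold v i.+1 (e v i.+1) lev; rewrite leqnn.
  by have := @down_step i (i + (e v i.+1).+1); rewrite addnS addSn; lia.
lia.
Qed.

End UpperTriangle.

Lemma walk_of_legal N (A : 'M[int]_N.+1) : legal 2 A ->
  exists2 l, l \in walks N origin & array_of_walk N l = A.
Proof.
move=> [[top bottom] [down right diag] near_max].
pose B i j : int := ((maxn i j)%:Z - A (inord i) (inord j))%R.
rewrite /equal_or_one_more in down right diag.
have dwn i j : i < N -> j <= N ->
    (A (inord i.+1) (inord j) = A (inord i) (inord j)
     \/ A (inord i.+1) (inord j) = A (inord i) (inord j) + 1)%R.
  by move=> ? ?; apply: down; rewrite !inordK //; lia.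
have rgt i j : i <= N -> j < N ->
    (A (inord i) (inord j.+1) = A (inord i) (inord j)
     \/ A (inord i) (inord j.+1) = A (inord i) (inord j) + 1)%R.
  by move=> ? ?; apply: right; rewrite !inordK //; lia.
have dgn i j : i < N -> j < N ->
    (A (inord i.+1) (inord j.+1) = A (inord i) (inord j)
     \/ A (inord i.+1) (inord j.+1) = A (inord i) (inord j) + 1)%R.
  by move=> ? ?; apply: diag; rewrite !inordK //; lia.
have B00 : B 0 0 = 0%R by rewrite /B top ?inordK.
have BNN : B N N = 2%R by rewrite /B bottom ?inordK //; lia.
have le2 i j : i <= N -> j <= N -> (B i j <= 2)%R.
  move=> ? ?; have := near_max (inord i) (inord j); rewrite !inordK // /B; lia.
have [p [pB pa pN ps]] : exists p : nat -> nat * nat,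
  [/\ forall i j, i <= j <= N -> B i j = ((level (p i) (j - i))%:Z)%R,
      forall i, i <= N -> admissible (p i),
      p N = (0, 0)
    & forall i, i < N -> p i \in half_successors (p i.+1)].
  apply: upper_levels => // i j *; rewrite /B.
  - by have := @rgt i j; lia.
  - by have := @dwn i j; lia.
  - by have := @dgn i j; lia.
(* The lower triangle is the upper one of the transpose. *)
have [q [qB qa qN qs]] : exists p : nat -> nat * nat,
  [/\ forall i j, i <= j <= N -> B j i = ((level (p i) (j - i))%:Z)%R,
      forall i, i <= N -> admissible (p i),
      p N = (0, 0)
    & forall i, i < N -> p i \in half_successors (p i.+1)].
  apply: upper_levels => // [i j|i j|i j|i j lei lej]; rewrite /B.
  - by have := @dwn j i; lia.
  - by have := @rgt j i; lia.
  - by have := @dgn j i; lia.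
  - exact: le2.
have diag_pq i : i <= N -> level (p i) 0 = level (q i) 0.
  by move=> lei; have := pB i i; have := qB i i; rewrite subnn; lia.
(* [origin] already stands for row N, so the list begins with row N-1. *)
pose l := mkseq (fun k => (p (N - k.+1), q (N - k.+1))) N.
have nth_l k : k <= N -> nth origin (origin :: l) k = (p (N - k), q (N - k)).
  by case: k => [|k] lek /=; [rewrite subn0 pN qN|rewrite nth_mkseq].
have Hl : l \in walks N origin.
  rewrite mem_walks size_mkseq eqxx /=; apply/andP; split.
    apply/(pathP origin) => k; rewrite size_mkseq => ltk.
    rewrite nth_l 1?ltnW // nth_mkseq // mem_successors /=.
    rewrite same_diagonal_level ?pa ?qa ?diag_pq ?eqxx ?andbT; [|lia..].
    by rewrite -(subnSK ltk) ps ?qs //; lia.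
  rewrite (last_nth origin) size_mkseq nth_l // subnn /final /=.
  have := pB 0 0 isT; have := qB 0 0 isT; rewrite B00 subnn /level.
  by case: (p 0) => [[|?] [|?]]; case: (q 0) => [[|?] [|?]].
exists l => //; apply/matrixP => i j; rewrite mxE.
have -> : A i j = ((maxn i j)%:Z - B i j)%R by rewrite /B !inord_val; lia.
have [lei lej] := (leq_ord i, leq_ord j).
case: (leqP i j) => leij.
  by rewrite /deficit leij nth_l ?leq_subr // subKn // pB ?leij.
by rewrite deficit_lower ?(ltnW leij) // nth_l ?leq_subr // subKn // qB ?(ltnW leij).
Qed.

Lemma card_square_arrays N :
  H 2 N.+1 N.+1 = \sum_(i < N) \sum_(a < i) theta (i - a.+1) a 1 ^ 2.
Proof.
rewrite -size_walks_origin.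
have -> : size (walks N origin) = size (map (array_of_walk N) (walks N origin)).
  by rewrite size_map.
have U : uniq (map (array_of_walk N) (walks N origin)).
  by rewrite map_inj_in_uniq ?walks_uniq //; exact: array_of_walk_inj.
rewrite /H; suff -> : legal_arrays 2 N.+1 N.+1 =
    [set` [fset A in map (array_of_walk N) (walks N origin)]%fset]%classic.
  by rewrite set_fsetK card_fseq undup_id.
apply/seteqP; split=> A /=.
  by move=> /walk_of_legal[l Hl <-]; rewrite inE; exact: map_f.
by rewrite inE => /mapP[l Hl ->]; exact: legal_array_of_walk.
Qed.

Local Open Scope R_scope.

(** * Closed forms and the recurrence *)

(** Real numbers let [field] handle the rational certificates; the instance below makes big operator
    lemmas apply to their sums. *)
Fact Rplus_associative : associative Rplus.
Proof. by move=> x y z; ring. Qed.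

HB.instance Definition _ :=
  Monoid.isComLaw.Build R 0 Rplus Rplus_associative Rplus_comm Rplus_0_l.

Lemma INR_addn m n : INR (m + n) = INR m + INR n.
Proof. exact: plus_INR. Qed.

Lemma INR_muln m n : INR (m * n) = INR m * INR n.
Proof. exact: mult_INR. Qed.

Lemma sum_nil (u : nat -> R) : \big[Rplus/0]_(0 <= a < 0) u a = 0.
Proof. exact: big_geq. Qed.

Lemma sum_recr n (u : nat -> R) :
  \big[Rplus/0]_(0 <= a < n.+1) u a = \big[Rplus/0]_(0 <= a < n) u a + u n.
Proof. exact: big_nat_recr. Qed.

Lemma INR_sum n (u : nat -> nat) :
  INR (\sum_(0 <= i < n) u i) = \big[Rplus/0]_(0 <= i < n) INR (u i).
Proof.
elim: n => [|n IH]; first by rewrite big_geq // sum_nil.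
by rewrite big_nat_recr // sum_recr INR_addn IH.
Qed.

(** * Binomial coefficients and their partial sums *)

Definition binR (n k : nat) : R := INR 'C(n, k).

Lemma binRS n k : binR n.+1 k.+1 = binR n k.+1 + binR n k.
Proof. by rewrite /binR binS INR_addn. Qed.

Lemma binR_sym s a : binR (s + a) s = binR (s + a) a.
Proof. by rewrite /binR -bin_sub ?leq_addr // addKn. Qed.

Lemma binR_up s a :
  binR (s + a).+1 a = binR (s + a) a * (INR s + INR a + 1) / (INR s + 1).
Proof.
have s1 : INR s + 1 <> 0 by have := pos_INR s; lra.
have := mul_bin_down (s + a).+1 a; rewrite -addSn addnK /= => /(congr1 INR).
rewrite !INR_muln !S_INR INR_addn -/(binR _ _) -/(binR _ _) => E.
by apply: (Rmult_eq_reg_l (INR s + 1)) => //; rewrite -E; field.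
Qed.

Lemma binR_diag s a :
  binR (s + a).+1 a.+1 = binR (s + a) a * (INR s + INR a + 1) / (INR a + 1).
Proof.
have a1 : INR a + 1 <> 0 by have := pos_INR a; lra.
have := mul_bin_diag (s + a).+1 a; rewrite /= => /(congr1 INR).
rewrite !INR_muln !S_INR INR_addn -/(binR _ _) -/(binR _ _) => E.
by apply: (Rmult_eq_reg_l (INR a + 1)) => //; rewrite -E; field.
Qed.

Definition bin_partial_sum (n c : nat) : R := \big[Rplus/0]_(0 <= i < c) binR n i.

Lemma bin_partial_sumS n c :
  bin_partial_sum n c.+1 = bin_partial_sum n c + binR n c.
Proof. by rewrite /bin_partial_sum sum_recr. Qed.

Lemma bin_partial_sum_Pascal n c :
  bin_partial_sum n.+1 c = bin_partial_sum n c + bin_partial_sum n c.-1.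
Proof.
case: c => [|c]; first by rewrite /bin_partial_sum !sum_nil; ring.
elim: c => [|c IH] /=.
  by rewrite /bin_partial_sum !sum_recr !sum_nil /= /binR !bin0; ring.
by rewrite !(bin_partial_sumS _ c.+1) IH bin_partial_sumS binRS /=; ring.
Qed.

Lemma bin_partial_sum_0n c : bin_partial_sum 0 c.+1 = 1.
Proof.
elim: c => [|c IH]; rewrite bin_partial_sumS ?IH.
  by rewrite /bin_partial_sum sum_nil /binR /=; ring.
by rewrite /binR bin0n /=; ring.
Qed.

(* Reflection principle.  The truncation of [k.+1 - D] is harmless, since the
   corresponding partial sums are empty. *)
Lemma rho_closed k D :
  INR (rho k D) = bin_partial_sum k.*2 (k + D).+1 - bin_partial_sum k.*2 (k.+1 - D).
Proof.
elim: k D => [|k IH] [|D]; rewrite ?rho0 ?addn0 ?subn0; try by rewrite /=; ring.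
  by rewrite subSS sub0n add0n bin_partial_sum_0n /bin_partial_sum sum_nil /=; ring.
rewrite [rho _ _]/= !INR_addn !IH doubleS !bin_partial_sum_Pascal.
have -> : (k.+1 + D.+1).+1 = (k + D.+2).+1 by lia.
have -> : (k.+2 - D.+1)%N = (k.+1 - D)%N by lia.
have -> : (k.+1 - D.+2)%N = (k.+1 - D).-1.-1 by lia.
have -> : (k.+1 - D.+1)%N = (k.+1 - D).-1 by lia.
rewrite !addnS /=; ring.
Qed.

(** Each free binary choice is one use of Pascal's rule: j while e_1 = 0, one when e_1 becomes
    positive, and 2a afterwards. *)
Lemma theta_closed j a y : (0 < y)%N ->
  INR (theta j a y) = bin_partial_sum (a.*2.+1 + j) (a + j + y).+1
                      - bin_partial_sum (a.*2.+1 + j) (a.+2 - y).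
Proof.
elim: j y => [|j IH] y y0 /=.
  rewrite INR_addn !rho_closed !addn0 !bin_partial_sum_Pascal.
  case: y y0 => // y _; rewrite !addnS /= !subSS.
  have -> : (a - y)%N = (a.+1 - y).-1 by lia.
  ring.
rewrite INR_addn !IH // !addnS !bin_partial_sum_Pascal /=.
by rewrite -subnS; ring.
Qed.

(** This is F(s, a); as a difference of partial sums it extends antisymmetrically to a > s. *)
Definition block_sum (s a : nat) : R :=
  bin_partial_sum (s + a) s.+1 - bin_partial_sum (s + a) a.+1.

Lemma theta_block_sum s a : (a < s)%N -> INR (theta (s - a.+1) a 1) = block_sum s a.
Proof.
move=> lt; rewrite theta_closed // /block_sum subn1 /=.
by congr (bin_partial_sum _ _ - bin_partial_sum _ _); lia.
Qed.

Lemma block_sum_antisym s a : block_sum s a = - block_sum a s.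
Proof. by rewrite /block_sum addnC; ring. Qed.

(** Pascal's rule doubles the sum up to one term at each end; these two combine into one
    binomial. *)
Lemma block_sumSl s a : block_sum s.+1 a = 2 * block_sum s a + binR (s + a).+1 a.
Proof.
have -> : binR (s + a).+1 a = binR (s + a) s.+1 + binR (s + a) a.
  by rewrite -addSn -binR_sym addSn binRS binR_sym.
rewrite /block_sum addSn !bin_partial_sum_Pascal /= !(bin_partial_sumS _ s.+1).
by rewrite !(bin_partial_sumS _ a); ring.
Qed.

Lemma block_sumSr s a : block_sum s a.+1 = 2 * block_sum s a - binR (s + a).+1 a.+1.
Proof.
rewrite block_sum_antisym block_sumSl (block_sum_antisym s a) (addnC s a).
by rewrite -addSn binR_sym; ring.
Qed.

Lemma block_sum_diag s : block_sum s s = 0.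
Proof. by rewrite /block_sum; ring. Qed.

(** The next four definitions are g, w, K and the unsquared boundary binomial of the overview. *)
Definition square_sum (s : nat) : R := \big[Rplus/0]_(0 <= a < s) (block_sum s a) ^ 2.

Definition mixed_sum (s : nat) : R :=
  \big[Rplus/0]_(0 <= a < s.+1)
    (4 * block_sum s a * binR (s + a).+1 a + binR (s + a).+1 a ^ 2).

Definition central_sum (s : nat) : R := \big[Rplus/0]_(0 <= a < s.+1) binR (s + a) a ^ 2.

Definition central (s : nat) : R := binR (s + s).+1 s.+1.

Lemma square_sumS s : square_sum s.+1 = 4 * square_sum s + mixed_sum s.
Proof.
(* The added term is F(s, s) = 0; both sums now have the same range. *)
have -> : square_sum s = \big[Rplus/0]_(0 <= a < s.+1) (block_sum s a) ^ 2.
  by rewrite sum_recr block_sum_diag /square_sum; ring.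
rewrite /square_sum /mixed_sum.
elim: {1 3 4}s.+1 => [|n IH]; first by rewrite !sum_nil; ring.
by rewrite !sum_recr IH block_sumSl; ring.
Qed.

Lemma denominators_neq0 s : INR s + 1 <> 0 /\ INR s + 2 <> 0 /\ 2 * INR s + 3 <> 0 /\
  2 * INR s + 5 <> 0.
Proof. by have := pos_INR s; lra. Qed.

Lemma central_sym s : binR (s + s).+1 s = central s.
Proof. by rewrite /central -addnS binR_sym. Qed.

Lemma central_double s : binR (s + s).+2 s.+1 = 2 * central s.
Proof. by rewrite binRS central_sym -/(central s); ring. Qed.

Lemma centralS s : central s.+1 = 2 * (2 * INR s + 3) / (INR s + 2) * central s.
Proof.
have [s1 [s2 _]] := denominators_neq0 s.
rewrite {1}/central (binR_diag s.+1 s.+1) addSn addnS.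
rewrite central_double.
by rewrite !S_INR; field; lra.
Qed.

Lemma central_sumS s :
  central_sum s.+1 = (INR s + 1) / (2 * (2 * INR s + 3)) * central_sum s
    + (4 + 5 * (INR s + 1) / (2 * (2 * INR s + 3))) * central s ^ 2.
Proof.
have [s1 [s2 [s3 s5]]] := denominators_neq0 s.
(* Gosper certificate for the difference of the two summands. *)
pose v n := binR (s + n) n ^ 2 * INR n ^ 2
  * (3 * (INR s + 1) / 2 + INR n) / ((2 * INR s + 3) * (INR s + 1) ^ 2).
have tele n : \big[Rplus/0]_(0 <= a < n) binR (s.+1 + a) a ^ 2 =
    (INR s + 1) / (2 * (2 * INR s + 3))
      * \big[Rplus/0]_(0 <= a < n) binR (s + a) a ^ 2 + v n.
  elim: n => [|n IH]; first by rewrite !sum_nil /v /=; field.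
  rewrite !sum_recr IH /v addSn addnS binR_up binR_diag S_INR.
  have n1 : INR n + 1 <> 0 by have := pos_INR n; lra.
  by field.
(* The extra term a = s+1 is C(2s+2, s+1)^2, which is 4 [central s ^ 2]. *)
rewrite {1}/central_sum sum_recr tele -/(central_sum s) /v addnS -/(central s).
rewrite addSn addnS central_double.
by rewrite S_INR; field.
Qed.

Lemma mixed_sumS s :
  mixed_sum s.+1 = - 2 * mixed_sum s
    - (15 * INR s + 38) * (INR s + 1) / (4 * (2 * INR s + 3) * (2 * INR s + 5))
      * central_sum s
    + ((127 * INR s ^ 4 + 815 * INR s ^ 3 + 1882 * INR s ^ 2 + 1854 * INR s + 660
        + 2 * (97 * INR s ^ 3 + 514 * INR s ^ 2 + 882 * INR s + 490) * (INR s + 1)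
        + 30 * (INR s + 2) * (2 * INR s + 3) * (INR s + 1) ^ 2
        + 4 * (2 * INR s + 3) * (INR s + 1) ^ 3)
       / (4 * (INR s + 2) ^ 2 * (2 * INR s + 3) * (2 * INR s + 5))
       + 4 * (2 * INR s + 3) ^ 2 / (INR s + 2) ^ 2) * central s ^ 2.
Proof.
have [s1 [s2 [s3 s5]]] := denominators_neq0 s.
(* The term of [v] with [block_sum] is a summation by parts; it leaves the
   summand 8 C(s+a+1,a+1) C(s+a+2,a) + 4 C(s+a+1,a) C(s+a+2,a) + C(s+a+2,a)^2
   + 2 C(s+a+1,a)^2, for which the rest of [v] is a Gosper certificate modulo
   C(s+a,a)^2. *)
pose q n := (127 * INR s ^ 4 + 815 * INR s ^ 3 + 1882 * INR s ^ 2 + 1854 * INR s + 660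
  + 2 * (97 * INR s ^ 3 + 514 * INR s ^ 2 + 882 * INR s + 490) * n
  + 30 * (INR s + 2) * (2 * INR s + 3) * n ^ 2 + 4 * (2 * INR s + 3) * n ^ 3)
  / (4 * (INR s + 1) ^ 2 * (INR s + 2) ^ 2 * (2 * INR s + 3) * (2 * INR s + 5)).
pose v n := binR (s + n) n ^ 2 *
  (8 * (INR s + INR n + 1) * INR n / ((INR s + 1) * (INR s + 2))
   + INR n ^ 2 * q (INR n))
  + 8 * block_sum s n * (binR (s.+1 + n).+1 n - binR (s + n).+1 n).
(* The bracket in [v] is C(s+n+1, n-1), kept as a difference since truncated subtraction would give
   1 instead of 0 at n = 0. *)
have diff n : binR (s.+1 + n.+1).+1 n.+1 - binR (s + n.+1).+1 n.+1 =
    binR (s.+1 + n).+1 n.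
  by rewrite addnS binRS addnS addSn; ring.
have tele n : \big[Rplus/0]_(0 <= a < n)
      (4 * block_sum s.+1 a * binR (s.+1 + a).+1 a + binR (s.+1 + a).+1 a ^ 2) =
    - 2 * \big[Rplus/0]_(0 <= a < n)
      (4 * block_sum s a * binR (s + a).+1 a + binR (s + a).+1 a ^ 2)
    - (15 * INR s + 38) * (INR s + 1) / (4 * (2 * INR s + 3) * (2 * INR s + 5))
      * \big[Rplus/0]_(0 <= a < n) binR (s + a) a ^ 2 + v n.
  elim: n => [|n IH].
    by rewrite !sum_nil /v /binR !bin0 /=; field.
  have n1 : INR n + 1 <> 0 by have := pos_INR n; lra.
  rewrite !sum_recr IH /v block_sumSl block_sumSr.
  rewrite diff !addnS (binR_up s.+1 n) addSn !binR_up !binR_diag /q !S_INR.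
  by field; have := pos_INR s; lra.
(* In the extra term a = s+1 only the squared binomial survives, as F(s+1, s+1) = 0. *)
rewrite {1}/mixed_sum sum_recr tele -/(mixed_sum s) -/(central_sum s) /v.
rewrite diff block_sum_diag block_sumSr block_sum_diag.
rewrite (binR_up s.+1 s.+1) (binR_up s.+1 s).
rewrite !addSn !addnS central_sym central_double -/(central s) /q !S_INR.
by field; have := pos_INR s; lra.
Qed.

(** * The recurrence for f *)

Lemma fSS s : IZR (f s.+2) = IZR (f s.+1) + square_sum s.
Proof.
rewrite /f !card_square_arrays big_ord_recr /= -!INR_IZR_INZ INR_addn.
congr (_ + _); rewrite -(big_mkord xpredT (fun a => theta (s - a.+1) a 1 ^ 2)%N).
rewrite INR_sum /square_sum.
rewrite big_nat_cond [RHS]big_nat_cond; apply: eq_bigr => a /andP[/andP[_ lta] _].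
by rewrite -mulnn INR_muln theta_block_sum //=; ring.
Qed.

Lemma IZR_pow_pos z p : IZR (z ^ Z.pos p) = IZR z ^ Pos.to_nat p.
Proof. by rewrite pow_IZR positive_nat_Z. Qed.

Local Open Scope Z_scope.

Theorem mainTheorem4 (m : nat) (hm : (1 <= m)%N) :
  let n := Z.of_nat m in
  32 * (n + 1) * (2 * n + 1) ^ 2
    * (1575 * n ^ 6 + 21285 * n ^ 5 + 117954 * n ^ 4 + 343020 * n ^ 3
       + 551943 * n ^ 2 + 465785 * n + 161046) * f m
  - 8 * (121275 * n ^ 9 + 1933470 * n ^ 8 + 13267683 * n ^ 7
         + 51280818 * n ^ 6 + 122556360 * n ^ 5 + 186866686 * n ^ 4
         + 180574335 * n ^ 3 + 105734340 * n ^ 2 + 33718283 * n + 4443102)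
      * f (m + 1)%N
  + 2 * (294525 * n ^ 9 + 4763070 * n ^ 8 + 33170868 * n ^ 7
         + 130145646 * n ^ 6 + 315713355 * n ^ 5 + 488415476 * n ^ 4
         + 478464380 * n ^ 3 + 283626704 * n ^ 2 + 91378536 * n + 12137328)
      * f (m + 2)%N
  + (294525 * n ^ 9 + 4668570 * n ^ 8 + 31877118 * n ^ 7
     + 122735586 * n ^ 6 + 292620525 * n ^ 5 + 445804136 * n ^ 4
     + 431097970 * n ^ 3 + 252913504 * n ^ 2 + 80866406 * n + 10688508)
      * f (m + 3)%N
  - (121275 * n ^ 9 + 1961820 * n ^ 8 + 13655808 * n ^ 7
     + 53503836 * n ^ 6 + 129484209 * n ^ 5 + 199650088 * n ^ 4
     + 194784258 * n ^ 3 + 114948300 * n ^ 2 + 36871922 * n + 4877748)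
      * f (m + 4)%N
  + 2 * (2 * n + 7)
      * (1575 * n ^ 6 + 11835 * n ^ 5 + 35154 * n ^ 4 + 52554 * n ^ 3
         + 41382 * n ^ 2 + 16118 * n + 2428) * (n + 3) ^ 2 * f (m + 5)%N
  = 0.
Proof.
case: m hm => // s _ n; apply: eq_IZR.
rewrite !addnS !addn0 !(plus_IZR, minus_IZR, mult_IZR, IZR_pow_pos).
rewrite -[Pos.to_nat 2]/2%nat -[Pos.to_nat 3]/3%nat -[Pos.to_nat 4]/4%nat.
rewrite -[Pos.to_nat 5]/5%nat -[Pos.to_nat 6]/6%nat -[Pos.to_nat 7]/7%nat.
rewrite -[Pos.to_nat 8]/8%nat -[Pos.to_nat 9]/9%nat.
have -> : IZR n = INR s.+1 by rewrite -INR_IZR_INZ.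
rewrite !fSS !square_sumS !mixed_sumS !central_sumS !centralS !S_INR.
(* The relation now holds identically in these five values, so they may be arbitrary reals; x >= 0
   keeps the denominators nonzero. *)
move: (IZR (f s.+1)) (square_sum s) (mixed_sum s) (central_sum s) (central s).
move: (INR s) (pos_INR s) => x x0 f0 G W K B.
field; lra.
Qed.
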